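(* Let $G$ be a finite simple graph, let $S\subseteq V(G)$ be $G$-admissible (i.e. $P(S;G)\neq\emptyset$), and let $L$ be a set of vertices with $V_{<2}(G)\subseteq L\subseteq V(G)$. Then the set of labelings output by the procedure $\mathcal A(G,S,L)$ is exactly $P(S,G,L)$.
   Context: For a finite simple graph $G$ with $N$ vertices, a labeling is a bijection $\ell:V(G)\to\{1,\ldots,N\}$; $\ell$ has a peak at $v$ if $\deg_G(v)\ge 2$ and $\ell(v)>\ell(w)$ for all neighbors $w$ of $v$. The peak set of $\ell$ is the set of its peaks; $P(S;G)$ is the set of labelings with peak set exactly $S$. $N_G(v)$ is the set of neighbors of $v$ in $G$, and $N_G(S)=\bigcup_{v\in S}N_G(v)$. $V_{<2}(G)$ is the set of vertices of $G$ of degree less than $2$. For $V_{<2}(G)\subseteq L\subseteq V(G)$, $P(S,G,L)$ is the set of labelings of $G$ whose peak set $S'$ satisfies $S\subseteq S'\subseteq S\cup (L\setminus N_G(S))$. For $v\in V(G)$, $G\setminus\{v\}$ is the graph obtained by deleting $v$ and its incident edges. The procedure $\mathcal A(G,S,L)$ (the Graph Peak Set Algorithm) returns a set of labelings of $G$ defined recursively: if $V(G)=\emptyset$ it returns the single empty labeling; otherwise, for each vertex $v\in S\cup(L\setminus N_G(S))$, set $S_v=S\setminus\{v\}$ and $L_v=(L\cup N_G(v))\setminus\{v\}$, and for every labeling $\ell'$ of $G\setminus\{v\}$ output by $\mathcal A(G\setminus\{v\},S_v,L_v)$, output the labeling $\ell$ of $G$ given by $\ell(v)=|V(G)|$ and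 $\ell(w)=\ell'(w)$ for $w\neq v$. The output of $\mathcal A(G,S,L)$ is the union over all such choices of $v$. *)

(* Defs.v *)
From HB Require Import structures.
From mathcomp Require Import all_boot.

Set Implicit Arguments.
Unset Strict Implicit.
Unset Printing Implicit Defensive.

(* Finite simple graphs; the empty graph is allowed. *)
Record sgraph := SGraph {
  vertex :> finType;
  adj : rel vertex;
  adj_sym : symmetric adj;
  adj_irrefl : irreflexive adj }.

Definition nbrs (G : sgraph) (v : G) : {set G} := [set w | adj v w].

Definition nbrsS (G : sgraph) (S : {set G}) : {set G} :=
  \bigcup_(v in S) nbrs v.

Definition deg (G : sgraph) (v : G) : nat := #|nbrs v|.

Definition Vlt2 (G : sgraph) : {set G} := [set v | deg v < 2].

(* l is a bijection from the vertices of G onto {1, ..., #|G|}. *)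
Definition is_labeling (G : sgraph) (l : {ffun G -> nat}) : bool :=
  [&& [forall v, 1 <= l v <= #|G|],
      injectiveb l
    & [forall i : 'I_#|G|, i.+1 \in codom l]].

Definition is_peak (G : sgraph) (l : {ffun G -> nat}) (v : G) : bool :=
  (2 <= deg v) && [forall w in nbrs v, l w < l v].

Definition peak_set (G : sgraph) (l : {ffun G -> nat}) : {set G} :=
  [set v | is_peak l v].

(* P(S; G) *)
Definition labelings_with_peaks (G : sgraph) (S : {set G}) :
    pred {ffun G -> nat} :=
  [pred l | is_labeling l && (peak_set l == S)].

Definition admissible (G : sgraph) (S : {set G}) : Prop :=
  exists l : {ffun G -> nat}, l \in labelings_with_peaks S.

(* P(S, G, L) *)
Definition labelings_between (G : sgraph) (S L : {set G}) :
    pred {ffun G -> nat} :=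
  [pred l | [&& is_labeling l,
                S \subset peak_set l
              & peak_set l \subset S :|: (L :\: nbrsS S)]].

Section Delete.
Variables (G : sgraph) (v : G).

Definition del_vertex : finType := {w : G | w != v}.

Definition del_adj : rel del_vertex := fun x y => adj (val x) (val y).

Lemma del_adj_sym : symmetric del_adj.
Proof. by move=> x y; apply: adj_sym. Qed.

Lemma del_adj_irrefl : irreflexive del_adj.
Proof. by move=> x; apply: adj_irrefl. Qed.

Definition del : sgraph := SGraph del_adj_sym del_adj_irrefl.

Lemma card_del : #|del| = #|G|.-1.
Proof. by rewrite card_sig -(cardC1 v); apply: eq_card. Qed.

(* A set of vertices of G that avoids v, as a set of vertices of G \ {v}. *)
Definition to_del (A : {set G}) : {set del} :=
  [set x : del_vertex | val x \in A].

(* The labeling of G that extends l' and gives v the largest label. *)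
Definition extend (l' : {ffun del -> nat}) : {ffun G -> nat} :=
  [ffun w => if (insub w : option del_vertex) is Some x then l' x else #|G|].

End Delete.

(* n is the number of vertices of G. On the empty graph [ffun=> 0] is the
   unique (empty) labeling. *)
Fixpoint peak_alg_rec (n : nat) (G : sgraph) (S L : {set G}) :
    seq {ffun G -> nat} :=
  if n is n'.+1 then
    flatten [seq [seq extend l' |
                   l' <- peak_alg_rec n' (to_del v (S :\ v))
                                         (to_del v ((L :|: nbrs v) :\ v))]
            | v <- enum (S :|: (L :\: nbrsS S))]
  else [:: [ffun=> 0]].

(* The Graph Peak Set Algorithm; its output set is the set of members of the
   list. *)
Definition peak_alg (G : sgraph) (S L : {set G}) : seq {ffun G -> nat} :=
  peak_alg_rec #|G| S L.

Lemma peak_algE (G : sgraph) (S L : {set G}) :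
  peak_alg S L =
    if #|G| == 0 then [:: [ffun=> 0]]
    else flatten [seq [seq extend l' |
                        l' <- peak_alg (to_del v (S :\ v))
                                       (to_del v ((L :|: nbrs v) :\ v))]
                 | v <- enum (S :|: (L :\: nbrsS S))].
Proof.
rewrite /peak_alg; case E: #|G| => [|n] //=; congr flatten.
by apply: eq_map => v; rewrite card_del E.
Qed.

Lemma extendT (G : sgraph) (v : G) (l' : {ffun del v -> nat}) :
  extend l' v = #|G|.
Proof. by rewrite ffunE insubF // eqxx. Qed.

Lemma extend_val (G : sgraph) (v : G) (l' : {ffun del v -> nat})
    (x : del_vertex v) :
  extend l' (val x) = l' x.
Proof. by rewrite ffunE valK. Qed.

(* Main.v *)
Require Import Defs.
From HB Require Import structures.
From mathcomp Require Import all_boot.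

Set Implicit Arguments.
Unset Strict Implicit.
Unset Printing Implicit Defensive.

(* The largest label of a labeling l in P(S, G, L) sits at a vertex v of
   S :|: (L :\: nbrsS S): it is a peak unless it has degree less than 2, and it
   is not adjacent to a peak.  Deleting v keeps every peak that is not adjacent
   to v, and any new peak is a neighbor of v, which is why nbrs v is added to
   L.  Hence l lies in P(S, G, L) iff its restriction lies in
   P(S_v, G \ v, L_v), and one concludes by induction on the number of
   vertices.  Admissibility is only used through the independence of S and the
   degree bound on S, which, unlike admissibility, visibly pass to S_v. *)

Definition peak_like (G : sgraph) (S : {set G}) : Prop :=
  {in S, forall x, 2 <= deg x} /\ {in S &, forall x y, ~~ adj x y}.

Lemma nbrsSP (G : sgraph) (S : {set G}) (x : G) :
  reflect (exists2 s, s \in S & adj s x) (x \in nbrsS S).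
Proof.
apply: (iffP bigcupP) => -[s sS].
  by rewrite inE => sx; exists s.
by move=> sx; exists s => //; rewrite inE.
Qed.

Lemma is_peakP (G : sgraph) (l : {ffun G -> nat}) (v : G) :
  reflect (2 <= deg v /\ forall w, adj v w -> l w < l v) (is_peak l v).
Proof.
apply: (iffP andP) => -[dv lv]; split=> //.
  by move=> w vw; move/forall_inP: lv; apply; rewrite inE.
by apply/forall_inP => w; rewrite inE; apply: lv.
Qed.

(** Of two adjacent peaks, each would need a larger label than the other. *)
Lemma admissible_peak_like (G : sgraph) (S : {set G}) :
  admissible S -> peak_like S.
Proof.
case=> l /andP[_ /eqP <-]; split=> [x|x y].
  by rewrite inE => /is_peakP[].
rewrite !inE => /is_peakP[_ lx] /is_peakP[_ ly]; apply/negP => xy.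
by have := ltn_trans (lx _ xy) (ly x _); rewrite ltnn adj_sym xy => /(_ isT).
Qed.

(** By counting: for injective [l] with values in range, [codom l] is a duplicate-free list of
    length [#|G|] inside [iota 1 #|G|], so it has the same members. *)
Lemma is_labelingP (G : sgraph) (l : {ffun G -> nat}) :
  reflect ((forall v, 0 < l v <= #|G|) /\ injective l) (is_labeling l).
Proof.
apply: (iffP and3P) => [[/forallP lG /injectiveP linj _]|[lG linj]] //.
split; [exact/forallP | exact/injectiveP |].
have sub : {subset codom l <= iota 1 #|G|}.
  by move=> _ /codomP[v ->]; rewrite mem_iota add1n ltnS.
have codom_uniq : uniq (codom l) by rewrite map_inj_uniq ?enum_uniq.
have [|_ codomE] := uniq_min_size codom_uniq sub.
  by rewrite size_codom size_iota.
by apply/forallP => i; rewrite codomE mem_iota add1n /= ltnS ltn_ord.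
Qed.

Lemma labeling_max (G : sgraph) (l : {ffun G -> nat}) :
  is_labeling l -> 0 < #|G| -> exists v, l v = #|G|.
Proof.
case/and3P=> _ _ /forallP lsurj G0.
have lt : #|G|.-1 < #|G| by rewrite prednK.
have /codomP[v] := lsurj (Ordinal lt).
by rewrite /= prednK // => lv; exists v.
Qed.

Lemma labelings_betweenE (G : sgraph) (S L : {set G}) (l : {ffun G -> nat}) :
  (l \in labelings_between S L) =
    [&& is_labeling l, S \subset peak_set l
      & peak_set l \subset S :|: (L :\: nbrsS S)].
Proof. by []. Qed.

Section DeleteVertex.
Variables (G : sgraph) (v : G).
Implicit Types (x y : del v) (l : {ffun del v -> nat}) (S L : {set G}).

Lemma del_cases (w : G) : w = v \/ exists x : del v, w = val x.
Proof.
have [->|wv] := eqVneq w v; first by left.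
by right; exists (Sub w wv); rewrite SubK.
Qed.

Lemma val_del_neq x : val x != v. Proof. by case: x. Qed.

Lemma card_delS : #|G| = #|del v|.+1.
Proof. by rewrite card_del prednK // (cardD1 v). Qed.

(** Since [v] is not a neighbor of [val x], [val] maps the neighbors of [x] bijectively onto those
    of [val x]. *)
Lemma deg_del x : ~~ adj v (val x) -> deg x = deg (val x).
Proof.
move=> vx; rewrite /deg -(card_imset _ val_inj); apply: eq_card => w.
apply/imsetP/idP => [[y xy ->]|]; first by move: xy; rewrite !inE.
rewrite inE; have [->|[y ->]] := del_cases w.
  by rewrite adj_sym (negPf vx).
by exists y; rewrite ?inE.
Qed.

Lemma deg_del_lt2 x : deg x < 2 -> deg (val x) < 2 \/ adj v (val x).
Proof.
have [|/deg_del ->] := boolP (adj v (val x)); first by right.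
by left.
Qed.

Lemma extend_restrict (l : {ffun G -> nat}) :
  l v = #|G| -> l = extend [ffun x : del v => l (val x)].
Proof.
move=> lv; apply/ffunP => w; have [->|[x ->]] := del_cases w.
  by rewrite extendT.
by rewrite extend_val ffunE.
Qed.

Lemma is_labeling_extend l' : is_labeling (extend l') = is_labeling l'.
Proof.
apply/is_labelingP/is_labelingP => -[lG linj]; split.
- move=> x; have := lG (val x); rewrite extend_val => /andP[-> /=].
  rewrite card_delS leq_eqVlt ltnS => /orP[/eqP l'x|//].
  (* The label [#|G|] is already taken by [v], so injectivity rules it out at [x]. *)
  have /linj/eqP : extend l' (val x) = extend l' v.
    by rewrite extend_val extendT card_delS.
  by rewrite (negPf (val_del_neq x)).
- move=> x y l'xy; apply/val_inj/linj; by rewrite !extend_val.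
- move=> w; have [->|[x ->]] := del_cases w.
    by rewrite extendT leqnn card_delS.
  by rewrite extend_val card_delS; case/andP: (lG x) => -> /leqW.
- have lt x : l' x < #|G| by rewrite card_delS ltnS; case/andP: (lG x).
  move=> w1 w2; have [->|[x ->]] := del_cases w1;
    have [->|[y ->]] := del_cases w2; rewrite ?extendT ?extend_val //.
  + by move=> E; have := lt y; rewrite -E ltnn.
  + by move=> E; have := lt x; rewrite E ltnn.
  + by move=> /linj ->.
Qed.

Lemma labeling_del_lt l' x : is_labeling l' -> l' x < #|G|.
Proof. by case/is_labelingP => /(_ x)/andP[_ lx] _; rewrite card_delS ltnS. Qed.

Lemma is_peak_extendT l' :
  is_labeling l' -> is_peak (extend l') v = (2 <= deg v).
Proof.
move=> lab; apply/is_peakP/idP => [[]//|dv]; split=> // w.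
have [->|[x -> _]] := del_cases w; first by rewrite adj_irrefl.
by rewrite extendT extend_val labeling_del_lt.
Qed.

(** A neighbor of [v] is beaten by the top label at [v]; any other vertex keeps its degree, its
    neighbors and their labels. *)
Lemma is_peak_extend l' x : is_labeling l' ->
  is_peak (extend l') (val x) = ~~ adj v (val x) && is_peak l' x.
Proof.
move=> lab; apply/is_peakP/andP => [[dx lx]|[vx /is_peakP[dx lx]]].
  have vx : ~~ adj v (val x).
    apply/negP; rewrite adj_sym => /lx; rewrite extendT extend_val.
    by rewrite ltnNge ltnW // labeling_del_lt.
  split=> //; apply/is_peakP; split=> [|y xy]; first by rewrite deg_del.
  by have := lx (val y) xy; rewrite !extend_val.
split=> [|w]; first by rewrite -deg_del.
have [->|[y ->]] := del_cases w; first by rewrite adj_sym (negPf vx).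
by rewrite !extend_val; apply: lx.
Qed.

(** Expresses the neighborhood inside [G], so that it can be compared with [nbrsS S]. *)
Lemma mem_nbrsS_del S x :
  (x \in nbrsS (to_del v (S :\ v))) = [exists s in S :\ v, adj s (val x)].
Proof.
apply/nbrsSP/exists_inP => [[s sS sx]|[w]].
  by exists (val s) => //; rewrite inE in sS.
have [->|[s ->]] := del_cases w; first by rewrite setD11.
by move=> sS sx; exists s; rewrite // inE.
Qed.

Lemma Vlt2_del L :
  Vlt2 G \subset L -> Vlt2 (del v) \subset to_del v ((L :|: nbrs v) :\ v).
Proof.
move=> /subsetP hL; apply/subsetP => x; rewrite !inE val_del_neq /=.
by case/deg_del_lt2 => [dx|->]; rewrite ?orbT // hL ?inE.
Qed.

(** Either [v] is in the independent set [S] or it is outside [nbrsS S]; in both cases it has no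
    neighbor in [S], so the deletion preserves degrees on [S :\ v]. *)
Lemma peak_like_del S L : peak_like S -> v \in S :|: (L :\: nbrsS S) ->
  {in S, forall s, ~~ adj v s} /\ peak_like (to_del v (S :\ v)).
Proof.
move=> [Sdeg Sind] vSL.
have nvS : {in S, forall s, ~~ adj v s}.
  move=> s sS; move: vSL; rewrite in_setU in_setD.
  case/orP=> [vS|/andP[/nbrsSP vNS _]]; first exact: Sind.
  by apply/negP; rewrite adj_sym => sv; apply: vNS; exists s.
split=> //; split=> [x|x y]; rewrite !inE.
  by case/andP=> _ xS; rewrite deg_del ?nvS // Sdeg.
by move=> /andP[_ xS] /andP[_ yS]; apply: Sind.
Qed.

Lemma labelings_between_extend S L l' :
    peak_like S -> Vlt2 G \subset L ->
  (extend l' \in labelings_between S L) =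
    (v \in S :|: (L :\: nbrsS S)) &&
    (l' \in labelings_between (to_del v (S :\ v))
                              (to_del v ((L :|: nbrs v) :\ v))).
Proof.
move=> Slike /subsetP hL; rewrite !labelings_betweenE.
rewrite is_labeling_extend; case lab: (is_labeling l'); last by rewrite andbF.
rewrite !andTb; apply/andP/and3P => -[].
  move=> /subsetP Sp /subsetP pSL.
  have nvS : {in S, forall s, ~~ adj v s}.
    move=> s /Sp; rewrite inE; have [->|[x ->]] := del_cases s.
      by rewrite adj_irrefl.
    by rewrite is_peak_extend // => /andP[].
  have Sp' x : val x \in S -> is_peak l' x.
    by move=> /Sp; rewrite inE is_peak_extend // => /andP[].
  split.
  (* With the top label, [v] is a peak if its degree is at least 2; otherwise it lies in [L], and it
     is not adjacent to [S]. *)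
  - have [dv|dv] := leqP 2 (deg v).
      by apply: pSL; rewrite inE is_peak_extendT.
    rewrite in_setU in_setD (hL v) ?inE // andbT; apply/orP; right.
    apply/nbrsSP => -[s sS]; rewrite adj_sym; exact/negP/nvS.
  - by apply/subsetP => x; rewrite !inE => /andP[_]; apply: Sp'.
  - apply/subsetP => x; rewrite inE => px.
    rewrite in_setU in_setD mem_nbrsS_del !inE val_del_neq /=.
    (* A neighbor of [x] in [S :\ v] would also be a peak of [l'], and two peaks are never
       adjacent. *)
    have nxS : ~~ [exists s in S :\ v, adj s (val x)].
      apply/exists_inP => -[w]; have [->|[s ->]] := del_cases w.
        by rewrite setD11.
      rewrite inE => /andP[_ /Sp'/is_peakP[_ ls]] sx.
      move/is_peakP: px => [_ /(_ s)]; rewrite /= /del_adj adj_sym => /(_ sx).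
      by rewrite ltnNge ltnW // ls.
    (* A neighbor of [v] belongs to the enlarged [L]; any other [x] is still a peak of [extend l'],
       so [pSL] applies. *)
    rewrite nxS /=; have [vx|vx] := boolP (adj v (val x)).
      by rewrite !orbT.
    have /pSL : val x \in peak_set (extend l') by rewrite inE is_peak_extend ?vx.
    by rewrite in_setU in_setD orbF => /orP[->|/andP[_ ->]]; rewrite ?orbT.
move=> vSL /subsetP Sp /subsetP pSL.
have [nvS _] := peak_like_del Slike vSL; split; apply/subsetP => w;
  have [->|[x ->]] := del_cases w => //.
- by move=> vS; rewrite inE is_peak_extendT //; case: Slike => ->.
- move=> xS; rewrite inE is_peak_extend // nvS //=.
  by have := Sp x; rewrite !inE xS val_del_neq; apply.
- rewrite inE is_peak_extend // => /andP[vx px].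
  have := pSL x; rewrite inE px => /(_ isT).
  rewrite !in_setU !in_setD mem_nbrsS_del !inE val_del_neq (negPf vx) orbF /=.
  case/orP=> [->//|/andP[nxS ->]]; rewrite andbT; apply/orP; right.
  (* A vertex [s] of [S] adjacent to [x] differs from [v], because [v] is not adjacent to [x]. *)
  apply: contra nxS => /nbrsSP[s sS sx]; apply/exists_inP; exists s => //.
  by rewrite !inE sS andbT; apply: contraNneq vx => sv; rewrite sv in sx.
Qed.

End DeleteVertex.

Lemma labelings_between_empty (G : sgraph) (S L : {set G})
    (l : {ffun G -> nat}) : #|G| = 0 ->
  (l \in labelings_between S L) = (l == [ffun=> 0]).
Proof.
move=> /card0_eq G0; have no (v : G) : False by have := G0 v; rewrite inE.
have -> : l = [ffun=> 0] by apply/ffunP => v; case: (no v).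
rewrite eqxx; apply/and3P; split; last 2 first.
- by apply/subsetP => v; case: (no v).
- by apply/subsetP => v; case: (no v).
by apply/is_labelingP; split=> v; case: (no v).
Qed.

Lemma mem_peak_alg (G : sgraph) (S L : {set G}) :
  peak_like S -> Vlt2 G \subset L -> peak_alg S L =i labelings_between S L.
Proof.
(* The induction generalizes over [G], since the recursive call works on a different vertex type. *)
have [n] := ubnP #|G|; elim: n => // n IHn in G S L * => ltGn Slike hL l.
rewrite peak_algE; case: eqVneq => [G0|G0].
  by rewrite labelings_between_empty // inE.
have IH v : v \in S :|: (L :\: nbrsS S) ->
    peak_alg (to_del v (S :\ v)) (to_del v ((L :|: nbrs v) :\ v)) =i
    labelings_between (to_del v (S :\ v)) (to_del v ((L :|: nbrs v) :\ v)).
  move=> vSL; apply: IHn; last exact: Vlt2_del.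
    by rewrite -ltnS -card_delS.
  by have [] := peak_like_del Slike vSL.
apply/flatten_mapP/idP => [[v]|lSL].
  rewrite mem_enum => vSL /mapP[l']; rewrite IH // => l'SL ->.
  by rewrite labelings_between_extend // vSL.
have /andP[lab _] := lSL.
(* The vertex with the largest label selects the branch of the algorithm that outputs [l]. *)
have [|v /extend_restrict lE] := labeling_max lab; first by rewrite lt0n.
move: lSL; rewrite lE labelings_between_extend // => /andP[vSL l'SL].
by exists v; rewrite ?mem_enum // map_f // IH.
Qed.

Theorem theorem2p6 (G : sgraph) (S L : {set G})
    (hS : admissible S) (hL : Vlt2 G \subset L) :
  peak_alg S L =i labelings_between S L.
Proof. exact: mem_peak_alg (admissible_peak_like hS) hL. Qed.
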